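(* Let $\mathcal V=\{V;\nu_1,\dots,\nu_n\}$ be a vector arrangement over $\Bbbk$ with associated hyperplane arrangement $\mathcal H$, and let $H_l\in\mathcal H$. There is a short exact sequence of chain complexes $$0\to\mathcal C_\partial(\mathcal H-H_l)\xrightarrow{\ \iota\ }\mathcal C_\partial(\mathcal H)\xrightarrow{\ \pi\ }\mathcal C_\partial(\mathcal H^{H_l})[1]\to0,$$ giving rise to a long exact sequence $$\cdots\to H_\partial^i(\mathcal H-H_l)\to H_\partial^i(\mathcal H)\to H_\partial^i(\mathcal H^{H_l})[1]\to H_\partial^{i+1}(\mathcal H-H_l)\to\cdots$$
   Context: Let $\Bbbk$ be a field of characteristic zero. A vector arrangement $\mathcal V=\{V;\nu_1,\dots,\nu_n\}$ is a finite-dimensional $\Bbbk$-vector space $V$ with an inner product together with a list of vectors $\nu_i\in V$ (zero allowed). The associated hyperplane arrangement is $\mathcal H=\{V;H_1,\dots,H_n\}$, $H_i=\nu_i^\perp$. For $S\subseteq[n]=\{1,\dots,n\}$ put $H_S=\bigcap_{s\in S}H_s$ ($H_\emptyset=V$). The inner product is understood to restrict non-degenerately to all subspaces onto which orthogonal projections are taken. Deletion: $\mathcal H-H_l$ is the arrangement in $V$ with $H_l$ removed (from $\mathcal V-\nu_l$). Restriction: $\mathcal H^{H_l}$ is the arrangement in $H_l$ consisting of the $H_i\cap H_l$, $i\neq l$ (from the vectors $P(\nu_i)$, $i\ne l$, with $P$ the orthogonal projection onto $\nu_l^\perp$). Chain complex $\mathcal C_\partial(\mathcal H)=\bigoplus_{S\subseteq[n]}\bigwedge^\bullet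 H_S$ with bigrading $\deg\bigwedge^iH_S=(|S|+i,\,i)$. For $s\in S$, $\partial_{S,s}:\bigwedge^\bullet H_S\to\bigwedge^{\bullet+1}H_{S-s}$ is inclusion followed by wedging on the left with the orthogonal projection of $\nu_s$ to $H_{S-s}$; the differential is $\partial=\bigoplus_{S,\,s\in S}\partial_{S,s}$, of bidegree $(0,1)$. The second degree is homological, and $H_\partial^i(\mathcal H)$ is the homology in second degree $i$. $[1]$ denotes a shift of the bigrading by $(1,0)$. *)

(* Defs.v *)
From HB Require Import structures.
From mathcomp Require Import all_boot all_order all_algebra.

Set Implicit Arguments.
Unset Strict Implicit.
Unset Printing Implicit Defensive.

Import Order.TTheory GRing.Theory Num.Theory.
Local Open Scope ring_scope.

Lemma sum_antisym (I : finType) (M : zmodType) (P : pred I) (F : I -> I -> M) :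
  (forall i j, P i -> P j -> i != j -> F i j = - F j i) ->
  \sum_(i | P i) \sum_(j | P j && (j != i)) F i j = 0.
Proof.
move=> antiF.
pose Q i j := [&& P i, P j & j != i].
rewrite (eq_bigr (fun i => \sum_(j | Q i j) F i j)); last first.
  by move=> i Pi; apply: eq_bigl => j; rewrite /Q Pi.
rewrite (pair_big_dep P Q F) /=.
rewrite (eq_bigl (fun p => Q p.1 p.2)); last first.
  by move=> [i j] /=; rewrite /Q; case: (P i).
rewrite (bigID (fun p : I * I => (enum_rank p.1 < enum_rank p.2)%N)) /=.
rewrite addrC (reindex_inj (h := fun p : I * I => (p.2, p.1))) /=; last first.
  by move=> [a b] [c d] /= [-> ->].
rewrite (eq_bigl (fun p => Q p.1 p.2 && (enum_rank p.1 < enum_rank p.2)%N)).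
  rewrite -big_split /= big1 // => -[i j] /= /andP[/and3P[Pi Pj ji] _].
  by rewrite antiF ?addNr // eq_sym.
move=> [i j] /=; rewrite /Q -leqNgt leq_eqVlt (inj_eq val_inj).
rewrite (inj_eq enum_rank_inj) [j == i]eq_sym.
by case: (P i); case: (P j) => //=; case: eqVneq.
Qed.

Section Exterior.

Variables (K : fieldType) (E : vectType K).

(* The exterior algebra of E, on the basis e_A = e_i1 /\ ... /\ e_ik, where
   A = {i1 < ... < ik} and (e_i) is the basis [vbasis fullv] of E. *)
Definition ext := {ffun {set 'I_(\dim {:E})} -> K^o}.
HB.instance Definition _ := Vector.on ext.

Definition ext1 : ext := [ffun A => (A == set0)%:R].

Implicit Types (u v w : E) (x y : ext) (U W : {vspace E}).

(* The sign is that of moving e_i to its place in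
   e_i /\ e_(A :\ i) = (-1)^#{j in A | j < i} e_A. *)
Definition ext_sign (A : {set 'I_(\dim {:E})}) i : K :=
  (-1) ^+ #|[set j in A | (j < i)%N]|.

Definition wedge_fun v x : ext :=
  [ffun A : {set _} => \sum_(i in A)
     ext_sign A i * coord (vbasis {:E}) i v * x (A :\ i)].

(* wedge v x is the exterior product v /\ x. *)
Definition wedge v : 'End(ext) := linfun (wedge_fun v).

Lemma wedge_fun_is_linear v : linear (wedge_fun v).
Proof.
move=> a x y; apply/ffunP=> A; rewrite !ffunE scaler_sumr -big_split /=.
apply: eq_bigr => i _; rewrite !ffunE mulrDr; congr (_ + _).
exact: mulrCA.
Qed.

HB.instance Definition _ v :=
  GRing.isLinear.Build K ext ext _ (wedge_fun v) (wedge_fun_is_linear v).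

Lemma wedgeE v x : wedge v x = wedge_fun v x.
Proof. by rewrite lfunE. Qed.

Lemma wedge_basis (i : 'I_(\dim {:E})) (A : {set 'I_(\dim {:E})}) :
  wedge (vbasis {:E})`_i [ffun B => (B == A)%:R] =
  [ffun B : {set _} => if i \in A then 0 else ext_sign B i * (B == i |: A)%:R].
Proof.
rewrite wedgeE; apply/ffunP=> B; rewrite !ffunE.
have coord_e k : coord (vbasis {:E}) k (vbasis {:E})`_i = (i == k)%:R.
  by rewrite coord_free // (basis_free (vbasisP _)).
have off k : k \in B -> k != i ->
    ext_sign B k * coord (vbasis {:E}) k (vbasis {:E})`_i
    * ([ffun B => (B == A)%:R] : ext) (B :\ k) = 0.
  by move=> _ nki; rewrite coord_e eq_sym (negPf nki) mulr0 mul0r.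
case: (boolP (i \in B)) => iB; last first.
  rewrite big1 => [|k kB].
    case: ifP => // _; case: eqP => [eqB|_]; last by rewrite mulr0.
    by rewrite eqB setU11 in iB.
  by rewrite off //; apply: contraNneq iB => <-.
rewrite (bigD1 i) //= big1 ?addr0 => [|k /andP[kB nki]]; last exact: off.
rewrite coord_e eqxx mulr1 ffunE.
have -> : (B :\ i == A) = (i \notin A) && (B == i |: A).
  apply/eqP/andP => [<-|[iA /eqP->]]; last exact: setU1K.
  by rewrite setD1K // setD11 eqxx.
by case: (i \in A); rewrite ?mulr0.
Qed.

Lemma wedge_linearl x : linear (fun v => wedge v x).
Proof.
move=> a u v; rewrite !wedgeE; apply/ffunP=> A.
rewrite !ffunE scaler_sumr -big_split /=.
apply: eq_bigr => i _; rewrite linearP /= mulrDr mulrDl; congr (_ + _).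
by rewrite [ext_sign A i * (a * _)]mulrCA -[in LHS]mulrA.
Qed.

Lemma ext_sign_swap (A : {set 'I_(\dim {:E})}) i j :
  i \in A -> j \in A -> i != j ->
  ext_sign A i * ext_sign (A :\ i) j = - (ext_sign A j * ext_sign (A :\ j) i).
Proof.
wlog ltij : i j / (i < j)%N => [IH|iA jA _].
  move=> iA jA nij; case: (ltngtP i j) => [lt|gt|/val_inj eq].
  - exact: IH.
  - by rewrite [in RHS]IH ?opprK // eq_sym.
  - by rewrite eq eqxx in nij.
have eq1 : [set k in A :\ j | (k < i)%N] = [set k in A | (k < i)%N].
  apply/setP=> k; rewrite !inE; case: eqVneq => //= ->.
  by rewrite ltnNge (ltnW ltij) andbF.
have eq2 : [set k in A | (k < j)%N] = i |: [set k in A :\ i | (k < j)%N].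
  apply/setP=> k; rewrite !inE; case: eqVneq => //= ->.
  by rewrite iA ltij.
rewrite /ext_sign eq1 eq2 cardsU1 !inE eqxx /= exprS mulN1r mulNr opprK.
exact: mulrC.
Qed.

Lemma wedgeK v x : wedge v (wedge v x) = 0.
Proof.
rewrite !wedgeE; apply/ffunP=> A; rewrite !ffunE.
pose c i : K := coord (vbasis {:E}) i v.
pose F (i j : 'I_(\dim {:E})) : K^o :=
  ext_sign A i * ext_sign (A :\ i) j * (c i * c j) * x (A :\ i :\ j).
rewrite -[RHS](@sum_antisym _ K^o (mem A) F).
  apply: eq_bigr => i iA; rewrite ffunE mulr_sumr.
  under eq_bigl => j do rewrite in_setD1 andbC.
  apply: eq_bigr => j _; rewrite /F -/(c i) -/(c j) !mulrA; congr (_ * _ * _).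
  exact: mulrAC.
move=> i j iA jA nij; rewrite /F ext_sign_swap // !mulNr [c j * _]mulrC.
by congr (- (_ * x _)); apply/setP=> k; rewrite !inE andbCA.
Qed.

Lemma wedgeC u v x : wedge u (wedge v x) = - wedge v (wedge u x).
Proof.
apply/eqP; rewrite -addr_eq0; apply/eqP.
have dl w1 w2 y : wedge (w1 + w2) y = wedge w1 y + wedge w2 y.
  by have := wedge_linearl y 1 w1 w2; rewrite !scale1r.
have := wedgeK (u + v) x.
by rewrite !dl linearD /= linearD /= !wedgeK add0r addr0.
Qed.

(* The i-th exterior power of U, as a subspace of that of E: it is spanned by
   the products u_1 /\ ... /\ u_i with the u_j in a basis of U. *)
Fixpoint extpow U (i : nat) : {vspace ext} :=
  if i is j.+1 then (\sum_(k < \dim U) wedge (vbasis U)`_k @: extpow U j)%VS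
  else <[ext1]>%VS.

Definition extpowz U (i : int) : {vspace ext} :=
  if i is Posz j then extpow U j else 0%VS.

Lemma mem_wedge U i u x :
  u \in U -> x \in extpow U i -> wedge u x \in extpow U i.+1.
Proof.
move=> uU xU; rewrite (coord_vbasis uU) /=.
pose f w := wedge w x.
have flin : linear f by exact: wedge_linearl.
pose fL : {linear E -> ext} :=
  HB.pack f (GRing.isLinear.Build K E ext _ f flin).
rewrite -[wedge _ _]/(fL _) linear_sum; apply: memv_sumr => k _.
by rewrite linearZ memvZ //; exact: memv_img.
Qed.

Lemma mem_wedgez U i u x :
  u \in U -> x \in extpowz U i -> wedge u x \in extpowz U (i + 1).
Proof.
case: i => [i|i] uU; last by rewrite /= memv0 => /eqP->; rewrite linear0 mem0v.
by rewrite -PoszD addn1; apply: mem_wedge.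
Qed.

Lemma extpowS U W i : (U <= W)%VS -> (extpow U i <= extpow W i)%VS.
Proof.
move=> sUW; elim: i => [|i IH] //=; apply/subv_sumP=> k _.
apply/subvP=> _ /memv_imgP[x xU ->]; apply: (@mem_wedge W).
  by apply: (subvP sUW); apply: vbasis_mem; apply: mem_nth; rewrite size_tuple.
exact: (subvP IH).
Qed.

Lemma extpowzS U W i : (U <= W)%VS -> (extpowz U i <= extpowz W i)%VS.
Proof. by case: i => // i /extpowS; apply. Qed.

End Exterior.

Section Complexes.

Variable K : fieldType.

(* Bigraded chain complexes, the differential having bidegree (0, 1). As in
   cx_shape, d p i j is only of interest when j = i + 1; having both i and j
   avoids transports along i = (i - 1) + 1. *)
Record bicomplex := Bicomplex {
  cx_obj :> int -> int -> vectType K;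
  cx_d : forall p i j, 'Hom(cx_obj p i, cx_obj p j);
  cx_shape : forall p i j, j != i + 1 -> cx_d p i j = 0;
  cx_dd : forall p i j k, (cx_d p j k \o cx_d p i j)%VF = 0
}.

Implicit Types A B C : bicomplex.

Record chain_map A B := ChainMap {
  cm_map :> forall p i, 'Hom(A p i, B p i);
  cm_comm : forall p i j,
    (cm_map p j \o cx_d A p i j = cx_d B p i j \o cm_map p i)%VF
}.

(* The shift [1]: the component of C in bidegree (p, i) is placed in bidegree
   (p + 1, i). *)
Definition shift C : bicomplex :=
  @Bicomplex (fun p i => C (p - 1) i) (fun p i j => cx_d C (p - 1) i j)
    (fun p => @cx_shape C (p - 1)) (fun p => @cx_dd C (p - 1)).

Definition cycles C p i : {vspace C p i} := lker (cx_d C p i (i + 1)).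
Definition boundaries C p i : {vspace C p i} := limg (cx_d C p (i - 1) i).

(* The quotient cycles / boundaries, realized on a complement of boundaries in
   cycles; the class of z is its component along that complement. See
   hclass_onto and hclass_eq0. *)
Definition homology C p i : vectType K :=
  subvs_of (cycles C p i :\: boundaries C p i).

Definition hclass_fun C p i (z : C p i) : homology C p i :=
  vsproj (cycles C p i :\: boundaries C p i)
    (addv_pi1 (cycles C p i) (boundaries C p i) z).

Definition hclass C p i : 'Hom(C p i, homology C p i) :=
  linfun (@hclass_fun C p i).

Definition hrep C p i : 'Hom(homology C p i, C p i) :=
  linfun (vsval : homology C p i -> C p i).

Definition hmap A B (f : chain_map A B) p i :
  'Hom(homology A p i, homology B p i) :=
  (hclass B p i \o f p i \o hrep A p i)%VF.

Lemma boundaries_cycles C p i : (boundaries C p i <= cycles C p i)%VS.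
Proof.
apply/subvP=> _ /memv_imgP[x _ ->]; rewrite memv_ker -comp_lfunE cx_dd.
by rewrite zero_lfunE.
Qed.

Lemma hclassE C p i (z : C p i) :
  vsval (hclass C p i z) = addv_pi1 (cycles C p i) (boundaries C p i) z.
Proof.
have lin : linear (@hclass_fun C p i).
  by move=> a u v; rewrite /hclass_fun !linearP.
pose fL : {linear C p i -> homology C p i} :=
  HB.pack (@hclass_fun C p i) (GRing.isLinear.Build K _ _ _ _ lin).
by rewrite /hclass (lfunE fL) /= /hclass_fun vsprojK ?memv_pi.
Qed.

Lemma hrepE C p i (h : homology C p i) : hrep C p i h = vsval h.
Proof.
by rewrite /hrep lfunE.
Qed.

Lemma hrepK C p i (h : homology C p i) : hclass C p i (hrep C p i h) = h.
Proof.
by apply: val_inj; rewrite /= hclassE hrepE daddv_pi_id ?capv_diff ?subvsP.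
Qed.

Lemma hrep_cycles C p i (h : homology C p i) : hrep C p i h \in cycles C p i.
Proof.
by rewrite hrepE; apply: (subvP (diffvSl _ (boundaries C p i))); apply: subvsP.
Qed.

Lemma hclass_onto C p i (h : homology C p i) :
  exists2 z, z \in cycles C p i & h = hclass C p i z.
Proof. by exists (hrep C p i h); rewrite ?hrepK ?hrep_cycles. Qed.

Lemma hclass_eq0 C p i (z : C p i) : z \in cycles C p i ->
  (hclass C p i z == 0) = (z \in boundaries C p i).
Proof.
move=> zZ; rewrite -(inj_eq val_inj) /= hclassE.
have zD := @addv_pi1_pi2 _ _ (cycles C p i) (boundaries C p i) z
  (subvP (addvSl _ _) _ zZ).
apply/eqP/idP => [z0|zB].
  by rewrite -zD z0 add0r memv_pi2.
apply/eqP; rewrite -memv0.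
have <- := capv_diff (cycles C p i) (boundaries C p i).
rewrite memv_cap memv_pi /=.
have -> : addv_pi1 (cycles C p i) (boundaries C p i) z =
          z - addv_pi2 (cycles C p i) (boundaries C p i) z.
  by rewrite -{2}zD addrK.
by rewrite memvB ?memv_pi2.
Qed.

Lemma cm_cycles A B (f : chain_map A B) p i z :
  z \in cycles A p i -> f p i z \in cycles B p i.
Proof.
rewrite !memv_ker -!comp_lfunE -cm_comm comp_lfunE => /eqP->.
by rewrite linear0.
Qed.

Lemma cm_boundaries A B (f : chain_map A B) p i z :
  z \in boundaries A p i -> f p i z \in boundaries B p i.
Proof.
case/memv_imgP=> x _ ->; rewrite -comp_lfunE cm_comm comp_lfunE.
exact/memv_img/memvf.
Qed.

Lemma hmapE A B (f : chain_map A B) p i z : z \in cycles A p i ->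
  hmap f p i (hclass A p i z) = hclass B p i (f p i z).
Proof.
move=> zZ; rewrite /hmap !comp_lfunE; apply/eqP; rewrite -subr_eq0 -!linearB.
set r := hrep _ _ _ _; have rZ : r \in cycles A p i by exact: hrep_cycles.
rewrite hclass_eq0; last exact/cm_cycles/memvB.
apply: cm_boundaries; rewrite -hclass_eq0 ?memvB // linearB /= /r hrepK.
by rewrite subrr.
Qed.

Definition short_exact A B C (f : chain_map A B) (g : chain_map B C) : Prop :=
  forall p i, [/\ lker (f p i) = 0%VS, limg (f p i) = lker (g p i)
                & limg (g p i) = fullv].

(* delta is the connecting map of the snake lemma: it sends the class of g b
   to that of a whenever f a = d b. *)
Definition connecting A B C (f : chain_map A B) (g : chain_map B C)
    (delta : forall p i, 'Hom(homology C p i, homology A p (i + 1))) : Prop :=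
  forall p i (b : B p i) (a : A p (i + 1)),
    f p (i + 1) a = cx_d B p i (i + 1) b ->
    delta p i (hclass C p i (g p i b)) = hclass A p (i + 1) a.

Definition long_exact A B C (f : chain_map A B) (g : chain_map B C)
    (delta : forall p i, 'Hom(homology C p i, homology A p (i + 1))) : Prop :=
  forall p i, [/\ limg (hmap f p i) = lker (hmap g p i),
                  limg (hmap g p i) = lker (delta p i)
                & limg (delta p i) = lker (hmap f p (i + 1))].

End Complexes.

Section Projections.

Variables (K : fieldType) (E : vectType K) (form : {symmetric E}).

Implicit Types (U : {vspace E}) (u v : E).

Definition nondegenerate_on U : Prop := (U :&: orthov form U)%VS = 0%VS.

Definition orthproj U : 'End(E) := daddv_pi U (orthov form U).

Lemma form_sym u v : form u v = form v u.
Proof. by rewrite hermC /= expr0 mul1r. Qed.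

Lemma addv_orthov U : nondegenerate_on U -> (U + orthov form U)%VS = fullv.
Proof.
move=> ndU; apply/eqP; rewrite eqEsubv subvf /=; apply/subvP=> v _.
pose f w : 'rV[K]_(\dim U) := \row_i form w (vbasis U)`_i.
have flin : linear f.
  by move=> a x y; apply/rowP=> i; rewrite !mxE linearPl.
pose fL : {linear E -> 'rV[K]_(\dim U)} :=
  HB.pack f (GRing.isLinear.Build K _ _ _ f flin).
have kerf w : linfun fL w = 0 -> w \in orthov form U.
  move=> /rowP fw; apply/mem_orthovP=> x /coord_vbasis->.
  rewrite linear_sumr big1 // => i _; rewrite linearZr /=.
  by have := fw i; rewrite lfunE /= !mxE => ->; rewrite mulr0.
have full : (linfun fL @: U)%VS = fullv.
  apply/eqP; rewrite eqEdim subvf /= limg_dim_eq.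
    by rewrite dimvf /dim /= mul1n.
  apply/eqP; rewrite -subv0; apply/subvP=> w.
  by rewrite memv_cap memv_ker -ndU memv_cap => /andP[-> /eqP /kerf].
have : linfun fL v \in (linfun fL @: U)%VS by rewrite full memvf.
case/memv_imgP=> u uU fvu; rewrite -(subrK u v) addrC memv_add //.
by apply: kerf; rewrite linearB /= fvu subrr.
Qed.

Lemma orthproj_mem U v : orthproj U v \in U.
Proof. exact: memv_pi. Qed.

Lemma orthproj_sub U v :
  nondegenerate_on U -> v - orthproj U v \in orthov form U.
Proof.
move=> ndU.
have vD : v \in (U + orthov form U)%VS by rewrite addv_orthov ?memvf.
rewrite -{1}(daddv_pi_add ndU vD) addrC addKr.
exact: memv_pi.
Qed.

Lemma form_orthproj U u v :
  nondegenerate_on U -> u \in U -> form (orthproj U v) u = form v u.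
Proof.
move=> ndU uU; have /mem_orthovP/(_ u uU)/eqP := orthproj_sub v ndU.
by rewrite linearBl subr_eq0 => /eqP.
Qed.

Lemma nondeg_eq0 U u : nondegenerate_on U -> u \in U ->
  {in U, forall v, form u v = 0} -> u = 0.
Proof.
move=> ndU uU orthu; apply/eqP; rewrite -memv0 -ndU memv_cap uU.
exact/mem_orthovP.
Qed.

End Projections.

Section Arrangements.

Variables (K : fieldType) (E : vectType K).

Section Flats.

Variables (V : {vspace E}) (form : {symmetric E}).

Definition hyperplane (v : E) : {vspace E} := (V :&: orthov form <[v]>)%VS.

(* H_S, the intersection of the H_s for s in S, taken in V. *)
Definition flat_of n (vec : 'I_n -> E) (S : {set 'I_n}) : {vspace E} :=
  (V :&: \bigcap_(s in S) hyperplane (vec s))%VS.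

Lemma mem_flat_of n (vec : 'I_n -> E) (S : {set 'I_n}) v :
  reflect (v \in V /\ forall s, s \in S -> form v (vec s) = 0)
          (v \in flat_of vec S).
Proof.
rewrite memv_cap; apply: (iffP andP) => [[vV vS]|[vV vS]]; split=> //.
  move=> s sS; move: vS => /subv_bigcapP /(_ s sS).
  by rewrite -memvE memv_cap mem_orthov1 => /andP[_ /eqP].
apply/subv_bigcapP=> s sS; rewrite -memvE memv_cap vV mem_orthov1 /=.
by apply/eqP/vS.
Qed.

End Flats.

(* The vector space V of an arrangement is a subspace of a vector space E, so
   that an arrangement, its deletions, its restrictions and all the H_S live in
   the same E (take V = fullv for an arrangement in E itself). The inner product
   of V is the restriction of va_form to V. The differential of the complex
   involves the orthogonal projections onto H_(S :\ s) for s in S, that is onto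
   the H_S for the proper subsets S. *)
Record vector_arrangement n := VectorArrangement {
  va_space : {vspace E};
  va_form : {symmetric E};
  va_vec : 'I_n -> E;
  va_vec_in : forall i, va_vec i \in va_space;
  va_nondeg : forall S : {set 'I_n}, S != [set: 'I_n] ->
    nondegenerate_on va_form (flat_of va_space va_form va_vec S)
}.

Definition flat n (A : vector_arrangement n) (S : {set 'I_n}) : {vspace E} :=
  flat_of (va_space A) (va_form A) (va_vec A) S.

Lemma mem_flat n (A : vector_arrangement n) (S : {set 'I_n}) v :
  reflect (v \in va_space A /\
           forall s, s \in S -> va_form A v (va_vec A s) = 0)
          (v \in flat A S).
Proof. exact: mem_flat_of. Qed.

Lemma lift_imset_neqT n (l : 'I_n) (S : {set 'I_n.-1}) :
  S != setT -> l |: [set lift l s | s in S] != setT.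
Proof.
apply: contraNneq => eqT; apply/eqP/setP=> s; rewrite in_setT.
have := in_setT (lift l s); rewrite -eqT !inE eq_sym (negPf (neq_lift l s)) /=.
by rewrite (mem_imset _ _ (@lift_inj _ l)).
Qed.

Section Deletion.

Variables (n : nat) (A : vector_arrangement n) (l : 'I_n).

Lemma deletion_flat (S : {set 'I_n.-1}) :
  flat_of (va_space A) (va_form A) (fun i => va_vec A (lift l i)) S
  = flat A [set lift l s | s in S].
Proof.
apply/vspaceP=> v; apply/mem_flat_of/mem_flat => -[vV vS]; split=> //.
  by move=> _ /imsetP[s sS ->]; apply: vS.
by move=> s sS; apply: vS; apply: imset_f.
Qed.

Lemma deletion_nondeg (S : {set 'I_n.-1}) : S != setT ->
  nondegenerate_on (va_form A)
    (flat_of (va_space A) (va_form A) (fun i => va_vec A (lift l i)) S).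
Proof.
move=> nS; rewrite deletion_flat; apply: va_nondeg.
apply/eqP=> eqT; have := in_setT l; rewrite -eqT => /imsetP[s _ /eqP].
by rewrite (negPf (neq_lift l s)).
Qed.

Definition deletion : vector_arrangement n.-1 :=
  VectorArrangement (fun i => va_vec_in A (lift l i)) deletion_nondeg.

Definition restr_space : {vspace E} :=
  hyperplane (va_space A) (va_form A) (va_vec A l).

Definition restr_vec (i : 'I_n.-1) : E :=
  orthproj (va_form A) restr_space (va_vec A (lift l i)).

Lemma restr_spaceE : restr_space = flat A [set l].
Proof.
apply/vspaceP=> v; rewrite memv_cap mem_orthov1.
apply/andP/mem_flat => -[vV vl]; split=> //.
  by move=> s /set1P->; apply/eqP.
by rewrite vl ?set11.
Qed.

Lemma restr_space_nondeg (i : 'I_n.-1) :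
  nondegenerate_on (va_form A) restr_space.
Proof.
rewrite restr_spaceE; apply: va_nondeg.
apply/eqP=> eqT; have := in_setT (lift l i).
by rewrite -eqT inE eq_sym (negPf (neq_lift l i)).
Qed.

Lemma restriction_flat (S : {set 'I_n.-1}) :
  flat_of restr_space (va_form A) restr_vec S
  = flat A (l |: [set lift l s | s in S]).
Proof.
apply/vspaceP=> v; apply/mem_flat_of/mem_flat => -[vV vS]; split=> //.
- by move: vV; rewrite memv_cap => /andP[].
- move=> s /setU1P[->|/imsetP[t tS ->]].
    by move: vV; rewrite memv_cap mem_orthov1 => /andP[_ /eqP].
  rewrite form_sym -(form_orthproj _ (restr_space_nondeg t) vV) form_sym.
  exact: vS.
- rewrite memv_cap vV mem_orthov1 /=.
  by apply/eqP/vS; rewrite setU11.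
move=> s sS; rewrite form_sym form_orthproj.
- by rewrite form_sym; apply: vS; rewrite setU1r ?imset_f.
- exact: restr_space_nondeg s.
rewrite memv_cap vV mem_orthov1 /=.
by apply/eqP/vS; rewrite setU11.
Qed.

Lemma restr_vec_in i : restr_vec i \in restr_space.
Proof. exact: orthproj_mem. Qed.

Lemma restriction_nondeg (S : {set 'I_n.-1}) : S != setT ->
  nondegenerate_on (va_form A) (flat_of restr_space (va_form A) restr_vec S).
Proof.
by move=> nS; rewrite restriction_flat; apply/va_nondeg/lift_imset_neqT.
Qed.

Definition restriction : vector_arrangement n.-1 :=
  VectorArrangement restr_vec_in restriction_nondeg.

End Deletion.

Section ChainComplex.

Variables (n : nat) (A : vector_arrangement n).

Definition chain_total : vectType K := {ffun {set 'I_n} -> ext E}.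

Definition summand_fun (S : {set 'I_n}) (x : ext E) : chain_total :=
  [ffun T : {set 'I_n} => if T == S then x else 0].

Definition summand S : 'Hom(ext E, chain_total) := linfun (summand_fun S).

Definition chains (p i : int) : {vspace chain_total} :=
  (\sum_(S : {set 'I_n} | (#|S|%:Z + i == p)%R)
     summand S @: extpowz (flat A S) i)%VS.

Definition bdry_component (S : {set 'I_n}) (s : 'I_n) : 'End(ext E) :=
  wedge (orthproj (va_form A) (flat A (S :\ s)) (va_vec A s)).

(* The component in T of the boundary is the sum over the pairs (S, s) such
   that S - s = T, that is S = T + s with s not in T. *)
Definition bdry_fun (x : chain_total) : chain_total :=
  [ffun T : {set 'I_n} => \sum_(s | s \notin T)
     bdry_component (s |: T) s ((x : {ffun _ -> _}) (s |: T))].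

Definition bdry : 'End(chain_total) := linfun bdry_fun.

Lemma bdry_fun_is_linear : linear bdry_fun.
Proof.
move=> a x y; apply/ffunP=> T; rewrite !ffunE scaler_sumr -big_split /=.
by apply: eq_bigr => s _; rewrite !ffunE linearP.
Qed.

HB.instance Definition _ :=
  GRing.isLinear.Build K chain_total chain_total _ bdry_fun bdry_fun_is_linear.

Lemma bdryE x : bdry x = bdry_fun x.
Proof. by rewrite lfunE. Qed.

Lemma summand_fun_is_linear S : linear (summand_fun S).
Proof.
move=> a x y; apply/ffunP=> T; rewrite !ffunE.
by case: eqP => //; rewrite scaler0 addr0.
Qed.

HB.instance Definition _ S :=
  GRing.isLinear.Build K (ext E) chain_total _ (summand_fun S)
    (summand_fun_is_linear S).

Lemma summandE S x : summand S x = summand_fun S x.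
Proof. by rewrite lfunE. Qed.

Lemma mem_chains p i (x : chain_total) :
  reflect (forall S : {set 'I_n}, (x : {ffun _ -> _}) S \in
             (if (#|S|%:Z + i == p)%R then extpowz (flat A S) i else 0%VS))
          (x \in chains p i).
Proof.
apply: (iffP idP) => [/memv_sumP[xs xsP ->] S|xP].
  rewrite sum_ffunE; apply: rpred_sum => T Tp.
  have /memv_imgP[y yT ->] := xsP T Tp.
  rewrite summandE ffunE; case: eqP => [->|_]; last exact: mem0v.
  by rewrite Tp.
have -> : x = \sum_(S : {set 'I_n} | #|S|%:Z + i == p)
               summand S ((x : {ffun _ -> _}) S).
  apply/ffunP=> T; rewrite sum_ffunE.
  under eq_bigr => S _ do rewrite summandE ffunE.
  case: (boolP (#|T|%:Z + i == p)) => [Tp|nTp].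
    rewrite (bigD1 T) //= eqxx big1 ?addr0 // => S /andP[_ /negPf nST].
    by rewrite eq_sym nST.
  have := xP T; rewrite (negPf nTp) memv0 => /eqP->.
  rewrite big1 // => S Sp; case: eqP => // eqTS.
  by rewrite eqTS Sp in nTp.
apply: memv_sumr => S Sp; apply: memv_img.
by have := xP S; rewrite Sp.
Qed.

Lemma bdry_chains p i x : x \in chains p i -> bdry x \in chains p (i + 1).
Proof.
move=> /mem_chains xP; apply/mem_chains=> T; rewrite bdryE ffunE.
apply: rpred_sum => s sT; have := xP (s |: T).
rewrite cardsU1 sT add1n.
have -> : (#|T|.+1%:Z + i == p) = (#|T|%:Z + (i + 1) == p).
  by rewrite -addn1 PoszD [i + 1]addrC addrA.
case: ifP => _; last first.
  by rewrite !memv0 => /eqP->; rewrite linear0.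
rewrite /bdry_component setU1K // => xS; apply: mem_wedgez.
  exact: orthproj_mem.
apply: (subvP (extpowzS _ _)) xS.
apply/subvP=> v /mem_flat[vV vS]; apply/mem_flat; split=> // t tT.
by apply: vS; rewrite setU1r.
Qed.

(* In U = H_T, a and b being the projections of nu_t and nu_s, the projection
   of nu_t onto H_(T + s), the orthogonal of b in U, is a up to a multiple of
   b. *)
Lemma bdry_comp (T : {set 'I_n}) s t (x : ext E) :
    s \notin T -> t \notin T -> t != s ->
  let P := orthproj (va_form A) (flat A T) in
  bdry_component (s |: T) s (bdry_component (t |: (s |: T)) t x)
  = wedge (P (va_vec A s)) (wedge (P (va_vec A t)) x).
Proof.
move=> sT tT ts P.
have tsT : t \notin s |: T by rewrite !inE negb_or ts.
rewrite /bdry_component !setU1K // -/P.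
set b := P _; set a := P _; set w := orthproj _ _ _.
set f := va_form A.
have ndT : nondegenerate_on f (flat A T).
  by apply: va_nondeg; apply/eqP=> eqT; rewrite eqT inE in tT.
have ndsT : nondegenerate_on f (flat A (s |: T)).
  by apply: va_nondeg; apply/eqP=> eqT; rewrite eqT inE in tsT.
have flatsT v : (v \in flat A (s |: T)) = (v \in flat A T) && (f v b == 0).
  apply/mem_flat/andP => [[vV vS]|[vT /eqP vb]].
    have vT : v \in flat A T.
      by apply/mem_flat; split=> // r rT; apply: vS; rewrite setU1r.
    split=> //; rewrite form_sym (form_orthproj _ ndT vT) form_sym vS //.
    exact: setU11.
  have /mem_flat[vV vS] := vT; split=> // r /setU1P[->|]; last exact: vS.
  by rewrite form_sym -(form_orthproj _ ndT vT) form_sym.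
have bT : b \in flat A T by exact: orthproj_mem.
have aT : a \in flat A T by exact: orthproj_mem.
have wsT : w \in flat A (s |: T) by exact: orthproj_mem.
have /andP[wT /eqP wb] : (w \in flat A T) && (f w b == 0) by rewrite -flatsT.
have aw v : v \in flat A (s |: T) -> f (a - w) v = 0.
  move=> vsT; have /andP[vT _] : (v \in flat A T) && (f v b == 0).
    by rewrite -flatsT.
  rewrite linearBl; apply/eqP; rewrite subr_eq0; apply/eqP.
  by transitivity (f (va_vec A t) v); [|symmetry]; exact: form_orthproj.
have [c eqaw] : exists c, a - w = c *: b.
  case: (eqVneq (f b b) 0) => [fbb|fbb].
    have b0 : b = 0.
      apply: (nondeg_eq0 ndsT); first by rewrite flatsT bT fbb eqxx.
      by move=> v; rewrite flatsT => /andP[_ /eqP fvb]; rewrite form_sym.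
    exists 0; rewrite scale0r; apply: (nondeg_eq0 ndT); first exact: memvB.
    move=> v vT; apply: aw; rewrite flatsT vT b0 /=.
    by rewrite linear0r.
  exists (f (a - w) b / f b b); set c := _ / _.
  apply/eqP; rewrite -subr_eq0; apply/eqP.
  have zT : a - w - c *: b \in flat A T by rewrite !memvB ?memvZ.
  apply: (nondeg_eq0 ndsT).
    by rewrite flatsT zT linearBl linearZl_LR /c /= divfK // subrr eqxx.
  move=> v vsT; rewrite linearBl linearZl_LR /= aw //.
  have /andP[_ /eqP fvb] : (v \in flat A T) && (f v b == 0) by rewrite -flatsT.
  by rewrite (form_sym _ b) fvb mulr0 subrr.
have -> : w = (- c) *: b + a by rewrite scaleNr -eqaw opprB subrK.
rewrite wedge_linearl linearD linearZ /= wedgeK.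
by rewrite scaler0 add0r.
Qed.

Lemma bdryK x : bdry (bdry x) = 0.
Proof.
rewrite !bdryE; apply/ffunP=> T; rewrite !ffunE.
pose P := orthproj (va_form A) (flat A T).
pose F s t := wedge (P (va_vec A s))
  (wedge (P (va_vec A t)) ((x : {ffun _ -> _}) (t |: (s |: T)))).
rewrite -[RHS](@sum_antisym _ _ (fun s => s \notin T) F).
  apply: eq_bigr => s sT; rewrite ffunE linear_sum.
  apply: eq_big => [t|t]; rewrite !inE negb_or 1?andbC // => /andP[tT ts].
  exact: bdry_comp.
by move=> s t sT tT _; rewrite /F wedgeC setUCA.
Qed.

Definition chain_diff_fun p i j (x : subvs_of (chains p i)) :
  subvs_of (chains p j) := vsproj (chains p j) (bdry (vsval x)).

(* The projection vsproj does nothing for j = i + 1, see chain_diffE. *)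
Definition chain_diff p i j : 'Hom(subvs_of (chains p i), subvs_of (chains p j))
  := if j == i + 1 then linfun (@chain_diff_fun p i j) else 0.

Lemma chain_diffE p i x : vsval (chain_diff p i (i + 1) x) = bdry (vsval x).
Proof.
have lin : linear (@chain_diff_fun p i (i + 1)).
  by move=> a u v; rewrite /chain_diff_fun !linearP.
pose fL : {linear subvs_of (chains p i) -> subvs_of (chains p (i + 1))} :=
  HB.pack (@chain_diff_fun p i (i + 1)) (GRing.isLinear.Build K _ _ _ _ lin).
rewrite /chain_diff eqxx (lfunE fL) /= /chain_diff_fun vsprojK //.
exact/bdry_chains/subvsP.
Qed.

Lemma chain_diff_shape p i j : j != i + 1 -> chain_diff p i j = 0.
Proof. by rewrite /chain_diff => /negPf->. Qed.

Lemma chain_diff_dd p i j k : (chain_diff p j k \o chain_diff p i j)%VF = 0.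
Proof.
case: (eqVneq j (i + 1)) => [->|nj]; last first.
  by rewrite (chain_diff_shape p nj) comp_lfun0r.
case: (eqVneq k (i + 1 + 1)) => [->|nk]; last first.
  by rewrite (chain_diff_shape p nk) comp_lfun0l.
apply/lfunP=> x; apply: val_inj.
by rewrite zero_lfunE comp_lfunE /= !chain_diffE bdryK.
Qed.

Definition chain_complex : bicomplex K :=
  Bicomplex chain_diff_shape chain_diff_dd.

(* The component in S of a chain. *)
Definition component p i (x : chain_complex p i) (S : {set 'I_n}) : ext E :=
  (vsval (x : subvs_of (chains p i)) : {ffun _ -> _}) S.

End ChainComplex.

(* The inclusion of the summands in S with l not in S, the set [n] - l being
   identified with 'I_n.-1 by lift l. *)
Definition is_inclusion n (A : vector_arrangement n) (l : 'I_n)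
    (iota : chain_map (chain_complex (deletion A l)) (chain_complex A))
    : Prop :=
  forall p i (x : chain_complex (deletion A l) p i) (S : {set 'I_n}),
    component (iota p i x) S =
    if l \in S then 0 else component x (lift l @^-1: S).

(* The projection onto the summands in S with l in S. *)
Definition is_projection n (A : vector_arrangement n) (l : 'I_n)
    (pi : chain_map (chain_complex A) (shift (chain_complex (restriction A l))))
    : Prop :=
  forall p i (x : chain_complex A p i) (S : {set 'I_n.-1}),
    component (pi p i x : chain_complex (restriction A l) (p - 1) i) S =
    component x (l |: [set lift l s | s in S]).

End Arrangements.

(* Main.v *)
From HB Require Import structures.
Require Import Defs.
From mathcomp Require Import all_boot all_order all_algebra.

Set Implicit Arguments.
Unset Strict Implicit.
Unset Printing Implicit Defensive.

Import GRing.Theory.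
Local Open Scope ring_scope.

(** Split the sets T of indices according to whether l lies in T, and write
    T = S or T = S + l, with S a set of the other indices. The flat of S is
    the same for H - H_l as for H, and the flat of S in the restriction to H_l
    is H_(S + l) (lemma [face_flat]), so that the chains of H split, as a
    bigraded vector space, into those of H - H_l and the shifted chains of the
    restriction.

    The differential respects this splitting up to one term. Let a component
    in T be sent to T - s. If s <> l, then T and T - s lie in the same half,
    and the map is the one in the complex of that half: this is clear for the
    deletion, while for the restriction it holds because projecting nu_s to H_l
    and then to the smaller space H_(T - s) is the same as projecting nu_s to
    H_(T - s) directly ([orthproj_orthproj], [face_bdry_component]). If s = l,
    the map goes from the half of the sets containing l to the other half, and
    never back. Hence the differential is block triangular ([slice_bdry]): the
    deletion is a subcomplex, and the quotient by it is the restriction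
    ([inclusion_projection_exact]).

    The long exact sequence is the one attached to any short exact sequence of
    complexes. Its connecting map is [snake]: lift a cycle through the
    surjection, apply the differential, and pull the result back through the
    injection. That this does not depend on the choices made is
    [snake_connecting]. Exactness ([connecting_long_exact]) only uses the
    defining property of the connecting map, on representatives. *)

(** * The long exact homology sequence *)

Section LongExactSequence.

Variable K : fieldType.
Implicit Types A B C : bicomplex K.

Lemma cx_ddE C p i j k (x : C p i) : cx_d C p j k (cx_d C p i j x) = 0.
Proof. by rewrite -comp_lfunE cx_dd zero_lfunE. Qed.

Lemma cm_commE A B (f : chain_map A B) p i j (x : A p i) :
  f p j (cx_d A p i j x) = cx_d B p i j (f p i x).
Proof. by rewrite -!comp_lfunE cm_comm. Qed.

Lemma mem_cycles C p i (z : C p i) :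
  (z \in cycles C p i) = (cx_d C p i (i + 1) z == 0).
Proof. exact: memv_ker. Qed.

(** [boundaries] in degree i + 1 is by definition the image of the differential
    from degree (i + 1) - 1, which is not convertible to i. *)
Lemma boundaries_succ C p i :
  boundaries C p (i + 1) = limg (cx_d C p i (i + 1)).
Proof. by rewrite /boundaries addrK. Qed.

Lemma cx_d_cycles C p i (b : C p i) :
  cx_d C p i (i + 1) b \in cycles C p (i + 1).
Proof. by rewrite mem_cycles cx_ddE. Qed.

Lemma cx_d_boundaries C p i (b : C p i) :
  cx_d C p i (i + 1) b \in boundaries C p (i + 1).
Proof. by rewrite boundaries_succ; exact/memv_img/memvf. Qed.

Lemma hclass_eqP C p i (z z' : C p i) :
  z \in cycles C p i -> z' \in cycles C p i ->
  reflect (hclass C p i z = hclass C p i z') (z - z' \in boundaries C p i).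
Proof.
move=> zZ z'Z; rewrite -hclass_eq0 ?memvB // linearB /= subr_eq0.
exact: eqP.
Qed.

Lemma hrep_hclass C p i (z : C p i) : z \in cycles C p i ->
  hrep C p i (hclass C p i z) - z \in boundaries C p i.
Proof. by move=> zZ; apply/hclass_eqP; rewrite ?hrepK ?hrep_cycles. Qed.

Section ShortExact.

Variables (A B C : bicomplex K) (f : chain_map A B) (g : chain_map B C).
Hypothesis fg_exact : short_exact f g.

Lemma short_exact_inj p i : injective (f p i).
Proof. by apply/lker0P; have [-> _ _] := fg_exact p i. Qed.

Lemma short_exact_comp p i (a : A p i) : g p i (f p i a) = 0.
Proof.
have [_ fg _] := fg_exact p i; apply/eqP.
by rewrite -memv_ker -fg; exact/memv_img/memvf.
Qed.

Lemma short_exact_lift p i (b : B p i) :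
  g p i b = 0 -> exists a, f p i a = b.
Proof.
have [_ fg _] := fg_exact p i => /eqP; rewrite -memv_ker -fg.
by case/memv_imgP=> a _ ->; exists a.
Qed.

Lemma short_exact_onto p i (c : C p i) : exists b, g p i b = c.
Proof.
have [_ _ gC] := fg_exact p i; have: c \in limg (g p i) by rewrite gC memvf.
by case/memv_imgP=> b _ ->; exists b.
Qed.

Lemma cycle_lift_differential p i (b : B p i) : g p i b \in cycles C p i ->
  exists a, f p (i + 1) a = cx_d B p i (i + 1) b.
Proof.
by rewrite mem_cycles -cm_commE => /eqP/short_exact_lift.
Qed.

Lemma snake_cycles p i (b : B p i) (a : A p (i + 1)) :
  f p (i + 1) a = cx_d B p i (i + 1) b ->
  g p i b \in cycles C p i /\ a \in cycles A p (i + 1).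
Proof.
move=> fa; rewrite !mem_cycles -cm_commE -fa short_exact_comp eqxx; split=> //.
apply/eqP/(@short_exact_inj p); rewrite linear0 cm_commE fa.
exact: cx_ddE.
Qed.

(** The inverses are linear one-sided inverses, so that the zigzag is linear by
    construction; independence of this choice of a lift is
    [snake_connecting]. *)
Definition snake p i : 'Hom(homology C p i, homology A p (i + 1)) :=
  (hclass A p (i + 1) \o (f p (i + 1))^-1 \o cx_d B p i (i + 1)
   \o (g p i)^-1 \o hrep C p i)%VF.

(** The lift b' chosen by [snake] and the given lift b have images differing by
    a boundary d (g b0), so that b' - b - d b0 comes from some a0; applying d
    shows that the two resulting cycles of A differ by d a0. *)
Lemma snake_connecting : connecting f g snake.
Proof.
move=> p i b a fa; have [gbZ aZ] := snake_cycles fa.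
have [_ _ gC] := fg_exact p i.
rewrite /snake !comp_lfunE; set c := hrep _ _ _ _.
have cZ : c \in cycles C p i by exact: hrep_cycles.
set b' := (g p i)^-1%VF c.
have gb' : g p i b' = c by rewrite limg_lfunVK // gC memvf.
have [a' fa'] : exists a', f p (i + 1) a' = cx_d B p i (i + 1) b'.
  by apply: cycle_lift_differential; rewrite gb'.
have [_ a'Z] := snake_cycles fa'.
rewrite -fa' lker0_lfunK; last by apply/lker0P/short_exact_inj.
apply/hclass_eqP => //.
have /memv_imgP[c0 _ c0E] := hrep_hclass gbZ.
have [b0 gb0] := short_exact_onto c0.
have [a0 fa0] : exists a0, f p i a0 = b' - b - cx_d B p (i - 1) i b0.
  by apply: short_exact_lift; rewrite !linearB /= gb' cm_commE gb0 -c0E subrr.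
have -> : a' - a = cx_d A p i (i + 1) a0; last exact: cx_d_boundaries.
apply: (@short_exact_inj p).
by rewrite linearB /= fa' fa cm_commE fa0 !linearB /= cx_ddE subr0.
Qed.

(** If the image of a cycle z is the boundary d (g b), then z - d b represents
    the same class as z and comes from A. *)
Lemma hmap_exact p i : limg (hmap f p i) = lker (hmap g p i).
Proof.
apply/vspaceP=> h; apply/idP/idP.
  case/memv_imgP=> k _ ->; have [z zZ ->] := hclass_onto k.
  by rewrite memv_ker !hmapE ?cm_cycles // short_exact_comp linear0.
have [z zZ ->] := hclass_onto h.
rewrite memv_ker hmapE // hclass_eq0 ?cm_cycles // => /memv_imgP[c _ gz].
have [b gb] := short_exact_onto c.
have [a fa] : exists a, f p i a = z - cx_d B p (i - 1) i b.
  by apply: short_exact_lift; rewrite linearB /= cm_commE gb gz subrr.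
have dbB : cx_d B p (i - 1) i b \in boundaries B p i by exact/memv_img/memvf.
have dbZ := subvP (boundaries_cycles _ _ _) _ dbB.
have aZ : a \in cycles A p i.
  rewrite mem_cycles; apply/eqP/(@short_exact_inj p).
  rewrite linear0 cm_commE fa; apply/eqP.
  by rewrite -mem_cycles memvB.
have -> : hclass B p i z = hmap f p i (hclass A p i a).
  rewrite hmapE // fa; apply/hclass_eqP => //; first exact: memvB.
  by rewrite opprB addrC subrK.
exact/memv_img/memvf.
Qed.

Variable delta : forall p i, 'Hom(homology C p i, homology A p (i + 1)).
Hypothesis deltaP : connecting f g delta.

(** If d b = f a and the class of a vanishes, say a = d a', then b may be
    replaced by the cycle b - f a', which has the same image in C. *)
Lemma connecting_exact_left p i : limg (hmap g p i) = lker (delta p i).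
Proof.
apply/vspaceP=> h; apply/idP/idP.
  case/memv_imgP=> k _ ->; have [z zZ ->] := hclass_onto k.
  (* A cycle z of B satisfies d z = f 0. *)
  rewrite memv_ker hmapE // (deltaP (a := 0)) ?linear0 //.
  by move: zZ; rewrite mem_cycles => /eqP->.
have [c cZ ->] := hclass_onto h.
have [b gb] := short_exact_onto c.
have [a fa] : exists a, f p (i + 1) a = cx_d B p i (i + 1) b.
  by apply: cycle_lift_differential; rewrite gb.
have [_ aZ] := snake_cycles fa.
rewrite memv_ker -gb (deltaP fa) hclass_eq0 // boundaries_succ.
case/memv_imgP=> a' _ aE.
have zZ : b - f p i a' \in cycles B p i.
  by rewrite mem_cycles linearB /= -fa -cm_commE -aE subrr.
have -> : hclass C p i (g p i b) = hmap g p i (hclass B p i (b - f p i a')).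
  by rewrite hmapE // linearB /= short_exact_comp subr0.
exact/memv_img/memvf.
Qed.

(** If f a = d b is a boundary, then g b is a cycle, and the class of a is the
    image of that of g b by the very definition of the connecting map. *)
Lemma connecting_exact_right p i :
  limg (delta p i) = lker (hmap f p (i + 1)).
Proof.
apply/vspaceP=> h; apply/idP/idP.
  case/memv_imgP=> k _ ->; have [c cZ ->] := hclass_onto k.
  have [b gb] := short_exact_onto c.
  have [a fa] : exists a, f p (i + 1) a = cx_d B p i (i + 1) b.
    by apply: cycle_lift_differential; rewrite gb.
  have [_ aZ] := snake_cycles fa.
  rewrite -gb (deltaP fa) memv_ker hmapE // fa.
  by rewrite hclass_eq0 ?cx_d_cycles ?cx_d_boundaries.
have [a aZ ->] := hclass_onto h.
rewrite memv_ker hmapE // hclass_eq0 ?cm_cycles // boundaries_succ.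
case/memv_imgP=> b _ fa; rewrite -(deltaP fa).
exact/memv_img/memvf.
Qed.

Lemma connecting_long_exact : long_exact f g delta.
Proof.
by move=> p i; split; [exact: hmap_exact | exact: connecting_exact_left
                      | exact: connecting_exact_right].
Qed.

End ShortExact.

End LongExactSequence.

(** * Sets of indices and the distinguished index *)

Section LiftSet.

Variables (n : nat) (l : 'I_n).
Implicit Types (b : bool) (S : {set 'I_n.-1}) (T : {set 'I_n}).

(** The sets of indices T are the [lift_set b S], uniquely, with b the truth
    value of l \in T: see [distinguished_lift_set], [lift_setK] and
    [preimset_liftK]. The boolean b selects the deletion (b = false) or the
    restriction (b = true) throughout. *)
Definition lift_set b S : {set 'I_n} :=
  if b then l |: [set lift l s | s in S] else [set lift l s | s in S].

Lemma mem_lift_set b S s : (lift l s \in lift_set b S) = (s \in S).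
Proof.
have memS : (lift l s \in [set lift l t | t in S]) = (s \in S).
  exact/mem_imset/lift_inj.
by case: b; rewrite /= ?inE memS // eq_sym (negPf (neq_lift l s)).
Qed.

Lemma distinguished_lift_set b S : (l \in lift_set b S) = b.
Proof.
case: b; rewrite /= ?setU11 //; apply/imsetP=> -[s _ /eqP].
by rewrite (negPf (neq_lift l s)).
Qed.

Lemma lift_setK b S : lift l @^-1: lift_set b S = S.
Proof. by apply/setP=> s; rewrite inE mem_lift_set. Qed.

Lemma preimset_liftK T : lift_set (l \in T) (lift l @^-1: T) = T.
Proof.
apply/setP=> s; case: (unliftP l s) => [t ->|->]; last first.
  exact: distinguished_lift_set.
by rewrite mem_lift_set inE.
Qed.

Lemma lift_setU1 b S s : lift l s |: lift_set b S = lift_set b (s |: S).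
Proof.
apply/setP=> t; case: (unliftP l t) => [r ->|->]; rewrite in_setU1.
  by rewrite !mem_lift_set in_setU1 (inj_eq lift_inj).
by rewrite !distinguished_lift_set (negPf (neq_lift l s)).
Qed.

Lemma card_lift_set b S : #|lift_set b S| = (b + #|S|)%N.
Proof.
have cardS : #|[set lift l s | s in S]| = #|S| by exact/card_imset/lift_inj.
by case: b (distinguished_lift_set false S) => //= lS; rewrite cardsU1 lS cardS.
Qed.

Lemma sum_notin_lift_set (M : nmodType) b S (F : 'I_n -> M) :
  \sum_(t | t \notin lift_set b S) F t =
  (if b then 0 else F l) + \sum_(s | s \notin S) F (lift l s).
Proof.
rewrite big_mkcond (bigD1_ord l) //= distinguished_lift_set if_neg.
congr (_ + _).
by rewrite [RHS]big_mkcond; apply: eq_bigr => s _; rewrite mem_lift_set.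
Qed.

End LiftSet.

(** * Decomposing chains along the distinguished index *)

Section Slices.

Variables (K : fieldType) (E : vectType K) (n : nat) (l : 'I_n).
Implicit Types (b : bool) (S : {set 'I_n.-1}) (T : {set 'I_n}).
Implicit Types (x : chain_total E n) (y : chain_total E n.-1).

Definition slice_fun b x : chain_total E n.-1 :=
  [ffun S : {set 'I_n.-1} => (x : {ffun _ -> _}) (lift_set l b S)].

Definition extend_fun b y : chain_total E n :=
  [ffun T : {set 'I_n} =>
     if (l \in T) == b then (y : {ffun _ -> _}) (lift l @^-1: T) else 0].

Lemma slice_fun_is_linear b : linear (slice_fun b).
Proof. by move=> a x y; apply/ffunP=> S; rewrite !ffunE. Qed.

Lemma extend_fun_is_linear b : linear (extend_fun b).
Proof.
move=> a x y; apply/ffunP=> T; rewrite !ffunE.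
by case: eqP; rewrite ?scaler0 ?addr0.
Qed.

HB.instance Definition _ b :=
  GRing.isLinear.Build K (chain_total E n) (chain_total E n.-1) _
    (slice_fun b) (slice_fun_is_linear b).
HB.instance Definition _ b :=
  GRing.isLinear.Build K (chain_total E n.-1) (chain_total E n) _
    (extend_fun b) (extend_fun_is_linear b).

Definition slice b : 'Hom(chain_total E n, chain_total E n.-1) :=
  linfun (slice_fun b).
Definition extend b : 'Hom(chain_total E n.-1, chain_total E n) :=
  linfun (extend_fun b).

Lemma sliceE b x S :
  (slice b x : {ffun _ -> _}) S = (x : {ffun _ -> _}) (lift_set l b S).
Proof. by rewrite lfunE ffunE. Qed.

Lemma extendE b y T :
  (extend b y : {ffun _ -> _}) T =
  if (l \in T) == b then (y : {ffun _ -> _}) (lift l @^-1: T) else 0.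
Proof. by rewrite lfunE ffunE. Qed.

(** [slice] and [extend] are the projections and injections of the
    decomposition of the chains as a direct sum of two copies of the functions
    on sets of the remaining indices. *)
Lemma slice_extend b b' y :
  slice b (extend b' y) = if b == b' then y else 0.
Proof.
apply/ffunP=> S; rewrite sliceE extendE distinguished_lift_set lift_setK.
by case: eqP; rewrite ?ffunE.
Qed.

Lemma eq_slices x x' : (forall b, slice b x = slice b x') -> x = x'.
Proof.
move=> eqx; apply/ffunP=> T; rewrite -(preimset_liftK l T) -!sliceE.
by rewrite eqx.
Qed.

Lemma extend_slice b x : slice (~~ b) x = 0 -> extend b (slice b x) = x.
Proof.
move=> x0; apply: eq_slices => b'; rewrite slice_extend.
by case: b b' x0 => [] [].
Qed.

End Slices.

Arguments slice {K E n} l b.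
Arguments extend {K E n} l b.

(** * The differential in terms of the deletion and the restriction *)

(** For u in U, pairing with u is unchanged by each of the projections, and U is
    non-degenerate. *)
Lemma orthproj_orthproj (K : fieldType) (E : vectType K)
    (form : {symmetric E}) (U W : {vspace E}) (v : E) :
  nondegenerate_on form U -> nondegenerate_on form W -> (U <= W)%VS ->
  orthproj form U (orthproj form W v) = orthproj form U v.
Proof.
move=> ndU ndW sUW; apply/eqP; rewrite -subr_eq0; apply/eqP.
apply: (nondeg_eq0 ndU) => [|u uU]; first by rewrite memvB ?orthproj_mem.
by rewrite linearBl /= !form_orthproj ?subrr // (subvP sUW).
Qed.

Section Faces.

Variables (K : fieldType) (E : vectType K) (n : nat).
Variables (A : vector_arrangement E n) (l : 'I_n).
Implicit Types (b : bool) (S : {set 'I_n.-1}).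

Definition face b : vector_arrangement E n.-1 :=
  if b then restriction A l else deletion A l.

Lemma face_flat b S : flat (face b) S = flat A (lift_set l b S).
Proof.
by case: b; [exact: restriction_flat | exact: (deletion_flat A l S)].
Qed.

(** Both sides wedge with a projection onto the same flat. In the restriction
    the vector projected is itself a projection, to H_l, and
    [orthproj_orthproj] applies; since s lies outside S, this flat is attached
    to a proper set of indices, and the form is non-degenerate on it. *)
Lemma face_bdry_component b S s : s \notin S ->
  bdry_component A (lift_set l b (s |: S)) (lift l s)
  = bdry_component (face b) (s |: S) s.
Proof.
move=> sS; rewrite /bdry_component -lift_setU1 setU1K ?mem_lift_set //.
rewrite setU1K // face_flat; case: b => //=.
rewrite /restr_vec orthproj_orthproj //; last 1 first.
- by rewrite -restriction_flat; exact: capvSl.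
- apply/va_nondeg/lift_imset_neqT; apply: contraNneq sS => ->.
  exact: in_setT.
exact: restr_space_nondeg s.
Qed.

(** The block form of the differential. Only sets T with l \notin T receive a
    contribution from removing l, since the sum defining the component in T
    runs over the indices outside T; this is the extra term for b = false. *)
Lemma slice_bdry b (x : chain_total E n) :
  slice l b (bdry A x) =
  (if b then 0 else [ffun S : {set 'I_n.-1} =>
     bdry_component A (lift_set l true S) l
       ((slice l true x : {ffun _ -> _}) S)])
  + bdry (face b) (slice l b x).
Proof.
apply/ffunP=> S; rewrite sliceE !bdryE !ffunE sum_notin_lift_set.
congr (_ + _); first by case: b; rewrite !ffunE ?sliceE.
apply: eq_bigr => s sS; rewrite lift_setU1 sliceE.
by rewrite face_bdry_component.
Qed.

Lemma bdry_extend_deletion (y : chain_total E n.-1) :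
  bdry A (extend l false y) = extend l false (bdry (deletion A l) y).
Proof.
apply: (@eq_slices _ _ _ l) => b; rewrite slice_bdry !slice_extend.
case: b => /=; first by rewrite linear0 addr0.
rewrite -[RHS]add0r; congr (_ + _).
by apply/ffunP=> S; rewrite !ffunE linear0.
Qed.

(** The index l adds 1 to the first degree: this is the shift [1] of the
    complex of the restriction. *)
Lemma degree_lift_set b S (p q i : int) : p = q + b%:Z ->
  (#|lift_set l b S|%:Z + i == p) = (#|S|%:Z + i == q).
Proof.
by move=> ->; rewrite card_lift_set PoszD -addrA addrC (inj_eq (addIr _)).
Qed.

Lemma slice_chains b (p q i : int) x : p = q + b%:Z ->
  x \in chains A p i -> slice l b x \in chains (face b) q i.
Proof.
move=> pq /mem_chains xP; apply/mem_chains=> S; rewrite sliceE face_flat.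
by rewrite -(degree_lift_set S i pq); exact: xP.
Qed.

Lemma extend_chains b (p q i : int) y : p = q + b%:Z ->
  y \in chains (face b) q i -> extend l b y \in chains A p i.
Proof.
move=> pq /mem_chains yP; apply/mem_chains=> T; rewrite extendE.
case: eqP => [lT|_]; last exact: mem0v.
have TE : T = lift_set l b (lift l @^-1: T) by rewrite -lT preimset_liftK.
rewrite {2 3}TE (degree_lift_set _ i pq) -face_flat.
exact: yP.
Qed.

End Faces.

(** * The short exact sequence *)

Section SubvsHom.

Variables (K : fieldType) (V W : vectType K).
Variables (U : {vspace V}) (U' : {vspace W}).

(** The values are forced into U' by a projection, which acts as the identity
    when F maps U into U', see [subvs_homE]. *)
Definition subvs_hom (F : 'Hom(V, W)) : 'Hom(subvs_of U, subvs_of U') :=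
  (linfun (vsproj U') \o F \o linfun (vsval : subvs_of U -> V))%VF.

Lemma subvs_homE (F : 'Hom(V, W)) (x : subvs_of U) :
  {in U, forall v, F v \in U'} -> vsval (subvs_hom F x) = F (vsval x).
Proof.
by move=> FU; rewrite !comp_lfunE !lfunE /= vsprojK // FU ?subvsP.
Qed.

End SubvsHom.

Section ShortExactSequence.

Variables (K : fieldType) (E : vectType K) (n : nat).
Variables (A : vector_arrangement E n) (l : 'I_n).

Let D := chain_complex (deletion A l).
Let C := chain_complex A.
Let R := shift (chain_complex (restriction A l)).

Definition inclusion_hom (p i : int) : 'Hom(D p i, C p i) :=
  subvs_hom (chains (deletion A l) p i) (chains A p i) (extend l false).

Definition projection_hom (p i : int) : 'Hom(C p i, R p i) :=
  subvs_hom (chains A p i) (chains (restriction A l) (p - 1) i)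
    (slice l true).

Lemma inclusion_homE p i (y : D p i) :
  vsval (inclusion_hom p i y) = extend l false (vsval y).
Proof.
apply: subvs_homE => v; apply: (@extend_chains _ _ _ _ _ false).
by rewrite addr0.
Qed.

Lemma projection_homE p i (x : C p i) :
  vsval (projection_hom p i x) = slice l true (vsval x).
Proof.
apply: subvs_homE => v; apply: (@slice_chains _ _ _ _ _ true).
by rewrite subrK.
Qed.

Lemma inclusion_comm p i j :
  (inclusion_hom p j \o cx_d D p i j = cx_d C p i j \o inclusion_hom p i)%VF.
Proof.
case: (eqVneq j (i + 1)) => [->|nj].
  apply/lfunP=> y; rewrite [LHS]comp_lfunE [RHS]comp_lfunE.
  apply: val_inj; rewrite /= inclusion_homE.
  by rewrite !chain_diffE inclusion_homE bdry_extend_deletion.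
by rewrite !cx_shape // comp_lfun0l comp_lfun0r.
Qed.

Lemma projection_comm p i j :
  (projection_hom p j \o cx_d C p i j = cx_d R p i j \o projection_hom p i)%VF.
Proof.
case: (eqVneq j (i + 1)) => [->|nj].
  apply/lfunP=> x; rewrite [LHS]comp_lfunE [RHS]comp_lfunE.
  apply: val_inj; rewrite /= projection_homE.
  by rewrite !chain_diffE projection_homE slice_bdry add0r.
by rewrite !cx_shape // comp_lfun0l comp_lfun0r.
Qed.

Definition inclusion : chain_map D C := ChainMap inclusion_comm.
Definition projection : chain_map C R := ChainMap projection_comm.

Lemma inclusionP : is_inclusion inclusion.
Proof.
move=> p i y S; rewrite /component inclusion_homE extendE.
by case: (l \in S).
Qed.

Lemma projectionP : is_projection projection.
Proof. by move=> p i x S; rewrite /component projection_homE sliceE. Qed.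

(** Surjectivity and exactness in the middle rest on extension by zero keeping
    chains inside the chains, and on a chain being recovered from its two
    slices. *)
Lemma inclusion_projection_exact : short_exact inclusion projection.
Proof.
move=> p i; split.
- apply/eqP/lker0P => y y' /(congr1 val); rewrite /= !inclusion_homE.
  move/(congr1 (slice l false)); rewrite !slice_extend eqxx.
  exact: val_inj.
- apply/vspaceP=> x; apply/memv_imgP/idP => [[y _ ->]|].
    rewrite memv_ker -val_eqE /= projection_homE inclusion_homE.
    by rewrite slice_extend.
  rewrite memv_ker -val_eqE /= projection_homE => /eqP x0.
  have yD : slice l false (vsval x) \in chains (deletion A l) p i.
    apply: (@slice_chains _ _ _ A l false p); last exact: subvsP.
    by rewrite addr0.
  exists (Subvs yD : D p i); first exact: memvf.
  by apply: val_inj; rewrite /= inclusion_homE /= extend_slice.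
apply/vspaceP=> y; rewrite memvf; apply/memv_imgP.
have xC : extend l true (vsval y) \in chains A p i.
  apply: (@extend_chains _ _ _ A l true p (p - 1)); last exact: subvsP.
  by rewrite subrK.
exists (Subvs xC : C p i); first exact: memvf.
by apply: val_inj; rewrite /= projection_homE slice_extend eqxx.
Qed.

End ShortExactSequence.

Theorem theorem2p9 (K : fieldType) (charK0 : [pchar K] =i pred0)
    (E : vectType K) (n : nat) (A : vector_arrangement E n) (l : 'I_n) :
  exists (iota : chain_map (chain_complex (deletion A l)) (chain_complex A))
         (pi : chain_map (chain_complex A)
                         (shift (chain_complex (restriction A l)))),
    [/\ is_inclusion iota, is_projection pi, short_exact iota pi
      & exists delta : forall p i : int,
            'Hom(homology (shift (chain_complex (restriction A l))) p i,
                 homology (chain_complex (deletion A l)) p (i + 1)),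
          connecting iota pi delta /\ long_exact iota pi delta].
Proof.
have ses := @inclusion_projection_exact K E n A l.
exists (inclusion A l), (projection A l).
split; [exact: inclusionP | exact: projectionP | exact: ses |].
exists (snake (inclusion A l) (projection A l)).
split; first exact: snake_connecting.
exact/connecting_long_exact/snake_connecting.
Qed.
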